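(* Let $b\ge2$ and $H\ge1$ be integers and let $\mathcal T$ be the balanced $b$-ary tree of depth $H$ (every non-leaf node has exactly $b$ children, all leaves at depth $H$). Under the negative feedback algorithm started at the root, $$\mathbb E_{\pi_{neg}}[T_C]\le 4H\,\frac{b+1}{b-1}\,b^H.$$
   Context: $T_C$ is the smallest $m$ such that $X_0,\dots,X_m$ visit all nodes of the tree. Negative feedback algorithm: for an edge from $i$ to $j$, let $N_{ij}^{(m)}$ be the number of times $t<m$ with $X_t=i,X_{t+1}=j$. Let $Smin_i^{(m)}$ be the set of neighbours $j$ of $i$ minimizing $N_{ij}^{(m)}$. If $X_m=i$, then given the past, $X_{m+1}$ is uniformly distributed on $Smin_i^{(m)}$. *)

(* Defs.v *)
From HB Require Import structures.
From mathcomp Require Import all_boot all_order all_algebra.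
From mathcomp Require Import all_classical all_reals all_analysis.

Set Implicit Arguments.
Unset Strict Implicit.
Unset Printing Implicit Defensive.

Import Order.TTheory GRing.Theory Num.Theory.
Import numFieldNormedType.Exports.
Local Open Scope classical_set_scope.
Local Open Scope ring_scope.

(* A node is the word, of length at most H, of the child indices chosen on the
   path from the root; the children of a node s of depth < H are the words
   rcons s c for c : 'I_b, and the words of length H are the leaves. *)
Definition tree_node (b H : nat) : finType := H.-bseq 'I_b.

Definition tree_root (b H : nat) : tree_node b H := [bseq].

Definition tree_adj (b H : nat) : rel (tree_node b H) := fun s t =>
  [exists c : 'I_b,
     (t == rcons s c :> seq 'I_b) || (s == rcons t c :> seq 'I_b)].

Section negative_feedback.
Variables (V : finType) (e : rel V).
Implicit Types (x : nat -> V) (m : nat) (i j : V).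

Definition edge_count x m i j : nat :=
  (\sum_(t < m) ((x t == i) && (x t.+1 == j)))%N.

Definition Smin x m i : {set V} :=
  [set j | e i j &
     [forall k, e i k ==> (edge_count x m i j <= edge_count x m i k)%N]].

Definition covered x m : Prop := forall v : V, exists2 t, (t <= m)%N & x t = v.

(* The infimum is the minimum, or +oo when x never visits some vertex. *)
Definition cover_time (R : realType) x : \bar R :=
  ereal_inf [set (m%:R)%:E | m in [set m | covered x m]].

Definition history (T : Type) (X : nat -> T -> V) x m : set T :=
  [set w | forall t, (t <= m)%N -> X t w = x t].

(* nf_step is the conditional law of X_(m+1) given (X_0, ..., X_m) = (x_0, ...,
   x_m), multiplied by the probability of that event so that histories of
   probability 0 impose no constraint; only x_0, ..., x_(m+1) matter there. *)
Record negative_feedback (r : V) (d : measure_display) (T : measurableType d)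
    (R : realType) (P : probability T R) (X : nat -> T -> V) : Prop := {
  nf_measurable : forall t v, measurable [set w | X t w = v] ;
  nf_start : P [set w | X 0%N w = r] = 1%E ;
  nf_step : forall m x,
    P (history X x m.+1) =
    (P (history X x m) *
     (if x m.+1 \in Smin x m (x m) then #|Smin x m (x m)|%:R^-1 else 0)%:E)%E
}.

End negative_feedback.

(* Main.v *)
(* The bound holds almost surely, not only in expectation. Almost surely every
   step of the walk goes along a least used edge, so at each node the counts of
   the outgoing edges differ by at most 1. On a tree, the edge from p to its child
   v has been crossed downwards as often as upwards, plus once if the walk is
   below v. If u has not been visited, all edges out of its parent have count at
   most 1, and climbing to the root each level adds at most 2, so all edges out of
   the root have count at most 2 H - 1. Downward counts do not increase with depth,
   so every downward edge has count at most 2 H - 1. At least half of the steps go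
   down, hence on a tree with n edges a walk that misses u has length at most
   2 n (2 H - 1) < 4 H n. *)

Require Import Defs.
From HB Require Import structures.
From mathcomp Require Import all_boot all_order all_algebra.
From mathcomp Require Import all_classical all_reals all_analysis.
From mathcomp Require Import measurable_realfun zify.

Set Implicit Arguments.
Unset Strict Implicit.
Unset Printing Implicit Defensive.

Import Order.TTheory GRing.Theory Num.Theory.
Local Open Scope classical_set_scope.
Local Open Scope ring_scope.

(** The combinatorics is done for one trajectory of this kind; [nf_path_ae] shows that almost all
    are. *)
Definition nf_path {V : finType} (e : rel V) (r : V) (x : nat -> V) : Prop :=
  x 0%N = r /\ forall m, x m.+1 \in Smin e x m (x m).

(** * Edge counts along one trajectory on an arbitrary graph *)

Section edge_counts.
Variables (V : finType) (e : rel V) (r : V) (x : nat -> V).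
Local Open Scope nat_scope.

Lemma edge_count0 i j : edge_count x 0 i j = 0.
Proof. by rewrite /edge_count big_ord0. Qed.

Lemma edge_countS m i j :
  edge_count x m.+1 i j = edge_count x m i j + ((x m == i) && (x m.+1 == j)).
Proof. by rewrite /edge_count big_ord_recr. Qed.

Lemma edge_count_unvisited m i j :
  (forall t, t <= m -> x t <> j) -> edge_count x m i j = 0.
Proof.
move=> unv; apply: big1 => t _.
by have /eqP/negPf-> := unv t.+1 (ltn_ord t); rewrite andbF.
Qed.

Hypothesis xP : nf_path e r x.

Lemma nf_path_adj m : e (x m) (x m.+1).
Proof. by have := xP.2 m; rewrite inE => /andP[]. Qed.

Lemma nf_path_min m k : e (x m) k ->
  edge_count x m (x m) (x m.+1) <= edge_count x m (x m) k.
Proof.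
by have := xP.2 m; rewrite inE => /andP[_ /forallP/(_ k)/implyP]; apply.
Qed.

(** Only a count that is minimal among the edges out of [i] ever grows, so right after growing it
    exceeds the others by at most 1. *)
Lemma edge_count_balanced m i j k : e i j -> e i k ->
  edge_count x m i j <= (edge_count x m i k).+1.
Proof.
move=> eij eik; elim: m => [|m IHm]; first by rewrite !edge_count0.
rewrite !edge_countS; have [xmi|_] /= := eqVneq (x m) i; last by rewrite !addn0.
have [xj|_] /= := eqVneq (x m.+1) j; last by lia.
have := nf_path_min (m := m) (k := k); rewrite xmi xj => /(_ eik); lia.
Qed.

End edge_counts.

Lemma prefix_rconsE (T : eqType) (s t : seq T) (c : T) :
  prefix s (rcons t c) = prefix s t || (s == rcons t c).
Proof.
by elim: s t => [|a s IHs] [|d t] //=; rewrite IHs eqseq_cons andb_orr.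
Qed.

(** * Trajectories on the tree *)

Section tree_walk.
Variables (b H : nat) (x : nat -> tree_node b H).
Hypothesis xP : nf_path (@tree_adj b H) (tree_root b H) x.
Implicit Types p u v w : tree_node b H.
Local Open Scope nat_scope.
Local Notation N := (edge_count x).

Lemma tree_adj_down p v c : v = rcons p c :> seq _ -> tree_adj p v.
Proof. by move=> vE; apply/existsP; exists c; rewrite vE eqxx. Qed.

Lemma tree_adj_up p v c : v = rcons p c :> seq _ -> tree_adj v p.
Proof. by move=> vE; apply/existsP; exists c; rewrite vE eqxx orbT. Qed.

Lemma walk_step m : exists c,
  x m.+1 = rcons (x m) c :> seq _ \/ x m = rcons (x m.+1) c :> seq _.
Proof.
by have /existsP[c /orP[/eqP|/eqP]] := nf_path_adj xP m; exists c; [left|right].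
Qed.

Lemma size_child p v c : v = rcons p c :> seq _ -> size v = (size p).+1.
Proof. by move->; rewrite size_rcons. Qed.

(** The edge is the only link between the subtree of [v] and the rest, so its directions alternate,
    downwards first since the walk starts at the root. *)
Lemma edge_count_down m p v c : v = rcons p c :> seq _ ->
  N m p v = N m v p + prefix v (x m).
Proof.
move=> vE; elim: m => [|m IHm].
  by rewrite !edge_count0 xP.1 prefixs0 vE; case: (val p).
rewrite !edge_countS {}IHm.
have szv := size_child vE.
have noloop (y z : tree_node b H) d : z = rcons y d :> seq _ ->
    (z == p) && (y == v) = false.
  move=> /size_child szz; apply/negP => /andP[/eqP zp /eqP yv].
  by move: szz; rewrite zp yv szv; lia.
(* A descent uses this with [y = x m], an ascent with [y = x m.+1]. *)
have step (y z : tree_node b H) d : z = rcons y d :> seq _ ->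
    prefix v z + ((y == v) && (z == p)) = prefix v y + ((y == p) && (z == v)).
  move=> zE; rewrite andbC (noloop _ _ _ zE) addn0 zE prefix_rconsE -zE.
  rewrite -[v == z :> seq _]/(v == z) [v == z]eq_sym.
  have [zv|_] := eqVneq z v; last by rewrite orbF andbF addn0.
  have -> : (y == p).
    by rewrite -val_eqE; move/eqP: vE; rewrite -zv zE eqseq_rcons => /andP[].
  rewrite orbT /=; case: prefixP => // -[s yE].
  have /eqP := size_child zE.
  by rewrite zv yE size_cat -addnS -{1}[size v]addn0 eqn_add2l.
have [d [/step|/step]] := walk_step m; first by lia.
by rewrite [(x m.+1 == v) && _]andbC [(x m.+1 == p) && _]andbC; lia.
Qed.

(* Inside the subtree of [v] this is balance plus [edge_count_down]. The walk
   leaves that subtree only by a step from [v] to [p], which raises the count of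
   that edge and so absorbs the defect 1 allowed by balance. *)
Lemma edge_count_child m p v u c d :
    v = rcons p c :> seq _ -> u = rcons v d :> seq _ ->
  N m v u <= N m p v.
Proof.
move=> vE uE; rewrite (edge_count_down m vE).
have avp := tree_adj_up vE; have avu := tree_adj_down uE.
elim: m => [|m IHm]; first by rewrite !edge_count0.
have := edge_count_balanced xP m.+1 avu avp.
have [_|nvx] := boolP (prefix v (x m.+1)); first by rewrite addn1.
rewrite !edge_countS => _; have [xv|nxv] /= := eqVneq (x m) v; last first.
  rewrite !addn0; move: IHm.
  have [vx|_] := boolP (prefix v (x m)); last by rewrite addn0.
  have [a [yE|xE]] := walk_step m.
    by move: nvx; rewrite yE prefix_rconsE vx.
  move: vx; rewrite xE prefix_rconsE (negPf nvx) -xE /=.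
  by move=> /eqP/val_inj vx; rewrite vx eqxx in nxv.
have xSp : x m.+1 = p.
  have [a [yE|xE]] := walk_step m.
    by move: nvx; rewrite yE prefix_rconsE xv prefix_refl.
  by apply/val_inj; move: xE; rewrite xv vE => /rcons_inj[].
have pu : (p == u) = false.
  apply/negP => /eqP pu; have := size_child vE; have := size_child uE.
  by rewrite pu; lia.
have := edge_count_balanced xP m avu avp.
by rewrite xSp pu !eqxx !addn0 addn1.
Qed.

Lemma node_prefix k v : exists p, p = take k v :> seq _.
Proof. by exists [bseq of take k v]. Qed.

Lemma node_parent v : v != tree_root b H -> exists p c, v = rcons p c :> seq _.
Proof.
rewrite -val_eqE /=; have := node_prefix (size v).-1 v.
case: (lastP (val v)) => [|s c] [p pE] //.
move: pE; rewrite size_rcons /= -cats1 take_size_cat // => pE _.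
by exists p, c; rewrite pE cats1.
Qed.

Lemma edge_count_down_le m M :
    (forall v, tree_adj (tree_root b H) v -> N m (tree_root b H) v <= M) ->
  forall p v c, v = rcons p c :> seq _ -> N m p v <= M.
Proof.
move=> rootM p; have [k] := ubnP (size p); elim: k p => // k IHk p szp v c vE.
have [p0|/node_parent[q [d pE]]] := eqVneq p (tree_root b H).
  by rewrite p0; apply: rootM; rewrite -p0; exact: tree_adj_down vE.
apply: leq_trans (edge_count_child m pE vE) _; apply: (IHk _ _ _ _ pE).
by move: szp; rewrite (size_child pE).
Qed.

(** Induction on the distance [n.+1] from [v] to [u]. The edge into [u] has count 0, so balance
    gives 1 at its parent. One level up, the downward count exceeds the upward one by at most 1, and
    balance adds 1 more. *)
Lemma edge_count_above_unvisited m u n v w :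
    (forall t, t <= m -> x t <> u) ->
    prefix v u -> size u = size v + n.+1 -> tree_adj v w ->
  N m v w <= n.*2.+1.
Proof.
move=> unv; elim: n v w => [|n IHn] v w /prefixP[[|c s] uE];
  rewrite uE size_cat => /eqP; rewrite eqn_add2l // => /eqP[szs] avw.
  have {}uE : u = rcons v c :> seq _ by rewrite uE (size0nil szs) cats1.
  have := edge_count_balanced xP m avw (tree_adj_down uE).
  by rewrite (edge_count_unvisited v unv).
have [p pE] := node_prefix (size v).+1 u.
have {}pE : p = rcons v c :> seq _.
  by rewrite pE uE -cat_rcons take_size_cat ?size_rcons.
have pu : prefix p u by rewrite uE pE -cat_rcons prefix_prefix.
have := IHn p v pu _ (tree_adj_up pE).
rewrite uE size_cat pE size_rcons /= szs addnS => /(_ erefl).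
have := edge_count_balanced xP m avw (tree_adj_down pE).
by rewrite (edge_count_down m pE); lia.
Qed.

(** A descent adds 1 to both time and depth; an ascent leaves their sum unchanged. *)
Lemma walk_time m :
  m + size (x m) = (\sum_(t < m) (size (x t) < size (x t.+1))).*2.
Proof.
elim: m => [|m IHm]; first by rewrite big_ord0 xP.1.
rewrite big_ord_recr /= doubleD -IHm.
by have [d [/size_child|/size_child]] := walk_step m => ->;
  rewrite ?ltnSn ?[_ < size _]ltnNge ?leqnSn /=; lia.
Qed.

Let par v : tree_node b H := [bseq of take (size v).-1 v].

(** Each descent is counted at the edge into the node it reaches. *)
Lemma walk_time_le m :
  m <= (\sum_(v | v != tree_root b H) N m (par v) v).*2.
Proof.
apply: leq_trans (leq_addr (size (x m)) m) _; rewrite walk_time leq_double.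
rewrite /edge_count exchange_big /=; apply: leq_sum => t _.
have [d [yE|/size_child->]] := walk_step t; last by rewrite ltnNge leqnSn.
rewrite (bigD1 (x t.+1)) /=; last by rewrite -val_eqE /= yE; case: (val (x t)).
rewrite eqxx andbT -val_eqE /= yE size_rcons -cats1 take_size_cat //.
by rewrite eqxx (leq_trans (leq_b1 _)) ?leq_addr.
Qed.

Lemma tree_walk_covered : 0 < H -> 0 < #|tree_node b H|.-1 ->
  covered x (4 * H * #|tree_node b H|.-1).
Proof.
move=> H0 n0 u; set m := 4 * H * _; apply: contrapT => unv.
have {}unv t : t <= m -> x t <> u by move=> tm xu; apply: unv; exists t.
have u0 : u <> tree_root b H by rewrite -xP.1 => /esym; exact: unv.
have szu : size u = (size u).-1.+1.
  rewrite prednK // lt0n size_eq0.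
  by apply/eqP => /(@val_inj _ _ _ _ (tree_root b H)).
(* The depth of [u] is at most [H], whence [2 (H - 1) + 1]. *)
have rootM v : tree_adj (tree_root b H) v -> N m (tree_root b H) v <= H.*2.-1.
  move=> av; have szuH : (size u).-1 < H by rewrite -szu; exact: size_bseq.
  have := @edge_count_above_unvisited m u _ _ v unv (prefix0s _) szu av.
  by move=> /leq_trans; apply; move: szuH; lia.
have : m <= (#|tree_node b H|.-1 * H.*2.-1).*2.
  apply: leq_trans (walk_time_le m) _; rewrite leq_double.
  rewrite -(cardC1 (tree_root b H)) -sum_nat_const.
  apply: leq_sum => v /node_parent[p [c vE]].
  apply: (edge_count_down_le rootM (c := c)).
  by rewrite vE /= vE size_rcons -cats1 take_size_cat // cats1.
(* With [n > 0] edges this would read [4 H n <= 4 H n - 2 n]. *)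
rewrite /m; nia.
Qed.

End tree_walk.

(** * Almost every trajectory obeys the rule *)

Section negative_feedback_paths.
Context (V : finType) (e : rel V) (r : V) (d : measure_display)
  (T : measurableType d) (R : realType) (P : probability T R)
  (X : nat -> T -> V).
Hypothesis hX : negative_feedback e r P X.

Lemma measurable_history (x : nat -> V) m : measurable (history X x m).
Proof.
rewrite [X in measurable X](_ : _ =
    \bigcap_(t in [set t | (t <= m)%N]) [set w | X t w = x t]) //.
by apply: bigcap_measurableType => t _; exact: nf_measurable hX _ _.
Qed.

(** Apart from a wrong start, a trajectory that breaks the rule has a finite history to which
    [nf_step] gives probability 0, and finite histories are countably many. *)
Lemma nf_path_ae : {ae P, forall w, nf_path e r (X^~ w)}.
Proof.
pose start := [set w | X 0%N w = r].
pose hist (s : seq V) := history X (nth r s) (size s).-1.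
(* A [k] that codes no word yields [[::]], whose history is the event of starting at [r]; the test
   on [P] keeps every [bad k] null. *)
pose bad k := let s := odflt [::] (unpickle k) in
  if P (hist s) == 0%E then hist s else set0.
have bad0 k : P.-negligible (bad k).
  rewrite /bad; case: ifPn => [/eqP P0|_]; last exact: negligible_set0.
  by apply/negligibleP => //; exact: measurable_history.
have start0 : P.-negligible (~` start).
  have mstart : measurable start := nf_measurable hX _ _.
  apply/negligibleP; first exact: measurableC.
  by apply: etrans (probability_setC P mstart) _; rewrite (nf_start hX) subee.
apply: negligibleS (negligibleU start0 (negligible_bigcup bad0)) => w /= nfw.
have [sw|] := pselect (start w); last by left.
right; apply: contrapT => nbad; apply: nfw; split=> // m; apply: contrapT => nS.
(* Length [m.+2] covers the times up to [m.+1], hence the offending step. *)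
apply: nbad; exists (pickle (mkseq (X^~ w) m.+2)) => //.
rewrite /bad pickleK /= /hist size_mkseq /=.
have -> : history X (nth r (mkseq (X^~ w) m.+2)) m.+1 = history X (X^~ w) m.+1.
  by apply/seteqP; split=> v /= hv t tm; have := hv t tm; rewrite nth_mkseq.
by rewrite (nf_step hX) (negPf (introN idP nS)) mule0 eqxx.
Qed.

End negative_feedback_paths.

(** * From the almost sure bound to the expectation *)

Import HBNNSimple.

(* [f] need not be measurable, and the measurability of [cover_time] is never
   established: the integral of a nonnegative function is the
   supremum of the integrals of the simple functions below it. *)
Lemma integral_le_ae_cst (d : measure_display) (T : measurableType d)
    (R : realType) (P : probability T R) (f : T -> \bar R) (K : R) :
    (forall w, 0 <= f w)%E -> 0 <= K -> {ae P, forall w, (f w <= K%:E)%E} ->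
  (\int[P]_w f w <= K%:E)%E.
Proof.
move=> f0 K0 fK; rewrite ge0_integralTE //; apply: ge_ereal_sup => _ [g gf <-].
rewrite -integralT_nnsfun.
have -> : K%:E = (\int[P]_w (cst K%:E w))%E.
  rewrite integral_cst // -[LHS]mule1; congr (_ * _)%E.
  exact: esym (probability_setT P).
apply: ae_ge0_le_integral => //.
- by move=> w _; rewrite lee_fin.
- exact/measurable_EFinP.
by apply: filterS fK => w fw _; exact: le_trans (gf w) fw.
Qed.

Lemma cover_time_ge0 (V : finType) (R : realType) (x : nat -> V) :
  (0 <= cover_time R x)%E.
Proof. by apply: le_ereal_inf_tmp => _ [m _ <-]; rewrite lee_fin. Qed.

Lemma cover_time_le (V : finType) (R : realType) (x : nat -> V) m :
  covered x m -> (cover_time R x <= m%:R%:E)%E.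
Proof. by move=> xm; apply: ereal_inf_lbound; exists m. Qed.

(** Geometric sum for the number [b + ... + b^H] of edges, with the denominator cleared. *)
Lemma card_tree_node (b H : nat) :
  (#|tree_node b H|.-1 * b.-1 = b ^ H.+1 - b)%N.
Proof.
rewrite card_bseq card_ord -subn1 mulnBl mul1n.
rewrite [X in (X - _)%N]mulnC -predn_exp.
by case: b => [|b']; rewrite ?exp0n //; lia.
Qed.

Theorem theorem8 (b H : nat) (hb : (2 <= b)%N) (hH : (1 <= H)%N)
    (R : realType) (d : measure_display) (T : measurableType d)
    (P : probability T R) (X : nat -> T -> tree_node b H)
    (hX : negative_feedback (@tree_adj b H) (tree_root b H) P X) :
  (\int[P]_w cover_time R (fun t => X t w)
   <= (4 * H%:R * ((b%:R + 1) / (b%:R - 1)) * b%:R ^+ H)%:E)%E.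
Proof.
set n := #|tree_node b H|.-1.
have cardE : (n * b.-1 = b ^ H.+1 - b)%N := card_tree_node b H.
have n0 : (0 < n)%N.
  have : (b < b ^ H.+1)%N by rewrite -[ltnLHS]expn1 ltn_exp2l.
  by move: cardE; case: (n) => //; lia.
apply: (@le_trans _ _ (4 * H * n)%:R%:E).
  apply: integral_le_ae_cst => // [w|]; first exact: cover_time_ge0.
  apply: filterS (nf_path_ae hX) => w wP.
  exact/cover_time_le/tree_walk_covered.
have b1 : 0 < b%:R - 1 :> R by rewrite subr_gt0 ltr1n.
rewrite lee_fin !natrM -[leRHS]mulrA ler_wpM2l ?mulr_ge0 //.
rewrite mulrAC ler_pdivlMr //.
have <- : b.-1%:R = b%:R - 1 :> R by rewrite -subn1 natrB //; exact: ltnW.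
(* It remains that [b^(H+1) - b <= b^H + b^(H+1)], the right side being [(b + 1) b^H]. *)
rewrite -natrX natr1 -!natrM ler_nat cardE mulSn -expnS.
by rewrite (leq_trans (leq_subr _ _)) ?leq_addl.
Qed.
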